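(* Let $i \ge 0$ be an integer and let $\varphi_i, \varphi_{i+1}, \varphi_{i+2}, \varphi_{i+3}$ be consecutive terms of the Fibonacci sequence. Let $f, g : \mathbb{R} \to \mathbb{R}$ be defined by $$f(x) = (\varphi_i \varphi_{i+3})\,x^2 + 2(\varphi_i \varphi_{i+3})(\varphi_{i+1}^2 + \varphi_{i+2}^2)\,x + (\varphi_i \varphi_{i+3})^3,$$ $$g(x) = 2(\varphi_{i+1}\varphi_{i+2})\,x^2 + 2^2(\varphi_{i+1}\varphi_{i+2})(\varphi_{i+1}^2 + \varphi_{i+2}^2)\,x + 2^3(\varphi_{i+1}\varphi_{i+2})^3 .$$ Let $$\theta_1 = -(\varphi_{i+1} - \varphi_{i+2})^2, \qquad \theta_2 = -(\varphi_{i+1} + \varphi_{i+2})^2,$$ which are roots of $f$, and let $$\phi_1 = -(\varphi_{i+1}^2 + \varphi_{i+2}^2) + \varphi_i\varphi_{i+3}, \qquad \phi_2 = -(\varphi_{i+1}^2 + \varphi_{i+2}^2) - \varphi_i\varphi_{i+3},$$ which are roots of $g$. Then $$\int_{\theta_2}^{\theta_1} f(x)\,dx \in \mathbb{Z} \qquad\text{and}\qquad \int_{\phi_2}^{\phi_1} g(x)\,dx \in \mathbb{Z}.$$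
   Context: The Fibonacci sequence $(\varphi_n)_{n\ge 0}$ is defined by $\varphi_0 = 0$, $\varphi_1 = 1$, and $\varphi_n = \varphi_{n-1} + \varphi_{n-2}$ for $n \ge 2$. The symbols $\phi_1,\phi_2$ denote the real numbers defined in the claim and are unrelated to the Fibonacci terms $\varphi_n$. *)

(* Defs.v *)
(* Classical real numbers of the Stdlib, with Coquelicot's Riemann integral. *)
From Stdlib Require Import Reals.
From Coquelicot Require Import Coquelicot.

Fixpoint fib (n : nat) : nat :=
  match n with
  | O => 0
  | S m => match m with
           | O => 1
           | S k => fib m + fib k
           end
  end.

Definition is_integer (x : R) : Prop := exists z : Z, x = IZR z.

(* Main.v *)
Require Import Defs.
From Stdlib Require Import Reals ZArith Lia.
From Coquelicot Require Import Coquelicot.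
Open Scope R_scope.

(** Put [a] and [b] for the Fibonacci terms of index [i + 1] and [i + 2]; the
    recurrence gives [b - a] and [a + b] for those of index [i] and [i + 3].
    Hence [p = b^2 - a^2] (the product of the outer terms), [q = 2 a b] and
    [s = a^2 + b^2] form a Pythagorean triple, [s^2 = p^2 + q^2], and

      [f x = p (x^2 + 2 s x + p^2)],   [g x = q (x^2 + 2 s x + q^2)].

    The two functions are one problem with the legs [p] and [q] exchanged: the
    roots of [x^2 + 2 s x + d^2] are [- s - e] and [- s + e] when
    [s^2 = d^2 + e^2], and the integral of [c (x^2 + 2 s x + d^2)] between them
    is [- 4 c e^3 / 3] ([is_RInt_quadratic_between_roots]). So the integrals are
    [- 4 p q^3 / 3] and [- 4 q p^3 / 3], and both are integers because 3 divides
    the product [p q] of the legs ([three_divides_product_of_legs]). *)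

Lemma quadratic_roots (c s d e : R) (f : R -> R)
  (Hf : forall x, f x = c * (x ^ 2 + 2 * s * x + d ^ 2))
  (Hs : s ^ 2 = d ^ 2 + e ^ 2) :
  f (- s + e) = 0 /\ f (- s - e) = 0.
Proof.
  rewrite !Hf; split.
  - replace ((- s + e) ^ 2 + 2 * s * (- s + e) + d ^ 2)
      with (d ^ 2 + e ^ 2 - s ^ 2) by ring.
    rewrite Hs; ring.
  - replace ((- s - e) ^ 2 + 2 * s * (- s - e) + d ^ 2)
      with (d ^ 2 + e ^ 2 - s ^ 2) by ring.
    rewrite Hs; ring.
Qed.

(** Centred at the vertex [- s], the quadratic is [c (y^2 - e^2)] on
    the interval from [- e] to [e]. Centring the antiderivative in the same way reduces the
    evaluation at the end points to a polynomial identity in [c] and [e]. *)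
Lemma is_RInt_quadratic_between_roots (c s d e : R) (f : R -> R)
  (Hf : forall x, f x = c * (x ^ 2 + 2 * s * x + d ^ 2))
  (Hs : s ^ 2 = d ^ 2 + e ^ 2) :
  is_RInt f (- s - e) (- s + e) (- (4 / 3) * (c * e ^ 3)).
Proof.
  set (F := fun x => c * ((x + s) ^ 3 / 3 - e ^ 2 * (x + s))).
  apply is_RInt_ext with (f := fun x => c * ((x + s) ^ 2 - e ^ 2)).
  { intros x _; rewrite Hf.
    change (c * ((x + s) ^ 2 - e ^ 2) = c * (x ^ 2 + 2 * s * x + d ^ 2)).
    replace (d ^ 2) with (s ^ 2 - e ^ 2) by (rewrite Hs; ring).
    ring. }
  replace (- (4 / 3) * (c * e ^ 3)) with (F (- s + e) - F (- s - e))
    by (unfold F; field).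
  apply (is_RInt_derive F).
  - intros x _; unfold F; auto_derive; [exact I | field].
  - intros x _; apply (ex_derive_continuous (V := R_NormedModule)).
    auto_derive; exact I.
Qed.

(** If 3 divides neither [a] nor [b], then [a^2] and [b^2] are both 1
    modulo 3. *)
Lemma three_divides_product_of_legs (a b : Z) :
  (3 | (b ^ 2 - a ^ 2) * (2 * a * b))%Z.
Proof.
  assert (residues : forall n : Z,
    exists k r : Z, n = (3 * k + r)%Z /\ (r = 0 \/ r = 1 \/ r = -1)%Z).
  { intro n.
    exists ((n + 1) / 3)%Z, ((n + 1) mod 3 - 1)%Z.
    pose proof (Z.div_mod (n + 1) 3 ltac:(lia)).
    pose proof (Z.mod_pos_bound (n + 1) 3 ltac:(lia)).
    lia. }
  destruct (residues a) as (k & r & -> & Hr).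
  destruct (residues b) as (l & t & -> & Ht).
  assert (H0 : forall m u : Z, (u = 0)%Z -> (3 | 3 * m + u)%Z).
  { intros m u ->; exists m; ring. }
  set (A := (3 * k + r)%Z); set (B := (3 * l + t)%Z).
  destruct Hr as [Hr | Hr].
  { apply Z.divide_mul_r, Z.divide_mul_l, Z.divide_mul_r.
    exact (H0 k r Hr). }
  destruct Ht as [Ht | Ht].
  { apply Z.divide_mul_r, Z.divide_mul_r. exact (H0 l t Ht). }
  apply Z.divide_mul_l.
  replace (B ^ 2 - A ^ 2)%Z
    with (3 * (3 * l ^ 2 + 2 * l * t - 3 * k ^ 2 - 2 * k * r)
          + (t ^ 2 - r ^ 2))%Z by (unfold A, B; ring).
  apply H0.
  destruct Hr as [-> | ->], Ht as [-> | ->]; reflexivity.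
Qed.

Lemma is_integer_four_thirds (c e : Z) (H : (3 | c * e)%Z) :
  is_integer (- (4 / 3) * (IZR c * IZR e ^ 3)).
Proof.
  destruct H as [m Hm].
  exists (- 4 * m * e ^ 2)%Z.
  rewrite Z.pow_2_r, !mult_IZR.
  replace (IZR c * IZR e ^ 3) with (IZR (c * e) * IZR e ^ 2)
    by (rewrite mult_IZR; ring).
  rewrite Hm, mult_IZR; field.
Qed.

Lemma quadratic_integral_is_integer (c e : Z) (s d : R) (f : R -> R)
  (Hf : forall x, f x = IZR c * (x ^ 2 + 2 * s * x + d ^ 2))
  (Hs : s ^ 2 = d ^ 2 + IZR e ^ 2) (H3 : (3 | c * e)%Z) :
  ex_RInt f (- s - IZR e) (- s + IZR e) /\
  is_integer (RInt f (- s - IZR e) (- s + IZR e)).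
Proof.
  pose proof (is_RInt_quadratic_between_roots (IZR c) s d (IZR e) f Hf Hs) as HI.
  split.
  - eexists; exact HI.
  - rewrite (is_RInt_unique _ _ _ _ HI).
    apply is_integer_four_thirds, H3.
Qed.

Lemma fib_outer_terms (i : nat) :
  INR (fib i) = INR (fib (i + 2)) - INR (fib (i + 1)) /\
  INR (fib (i + 3)) = INR (fib (i + 2)) + INR (fib (i + 1)).
Proof.
  replace (i + 3)%nat with (S (S (S i))) by lia.
  replace (i + 2)%nat with (S (S i)) by lia.
  replace (i + 1)%nat with (S i) by lia.
  change (fib (S (S (S i)))) with (fib (S (S i)) + fib (S i))%nat.
  change (fib (S (S i))) with (fib (S i) + fib i)%nat.
  rewrite !plus_INR; split; ring.
Qed.

Theorem mainTheorem3 (i : nat) (f g : R -> R) (theta1 theta2 phi1 phi2 : R)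
  (Hf : forall x : R,
     f x = (INR (fib i) * INR (fib (i + 3))) * x ^ 2
           + 2 * (INR (fib i) * INR (fib (i + 3)))
               * (INR (fib (i + 1)) ^ 2 + INR (fib (i + 2)) ^ 2) * x
           + (INR (fib i) * INR (fib (i + 3))) ^ 3)
  (Hg : forall x : R,
     g x = 2 * (INR (fib (i + 1)) * INR (fib (i + 2))) * x ^ 2
           + 2 ^ 2 * (INR (fib (i + 1)) * INR (fib (i + 2)))
               * (INR (fib (i + 1)) ^ 2 + INR (fib (i + 2)) ^ 2) * x
           + 2 ^ 3 * (INR (fib (i + 1)) * INR (fib (i + 2))) ^ 3)
  (Htheta1 : theta1 = - (INR (fib (i + 1)) - INR (fib (i + 2))) ^ 2)
  (Htheta2 : theta2 = - (INR (fib (i + 1)) + INR (fib (i + 2))) ^ 2)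
  (Hphi1 : phi1 = - (INR (fib (i + 1)) ^ 2 + INR (fib (i + 2)) ^ 2)
                  + INR (fib i) * INR (fib (i + 3)))
  (Hphi2 : phi2 = - (INR (fib (i + 1)) ^ 2 + INR (fib (i + 2)) ^ 2)
                  - INR (fib i) * INR (fib (i + 3))) :
  (f theta1 = 0 /\ f theta2 = 0) /\
  (g phi1 = 0 /\ g phi2 = 0) /\
  (ex_RInt f theta2 theta1 /\ is_integer (RInt f theta2 theta1)) /\
  (ex_RInt g phi2 phi1 /\ is_integer (RInt g phi2 phi1)).
Proof.
  destruct (fib_outer_terms i) as [H0 H3].
  rewrite H0, H3 in Hf, Hphi1, Hphi2; clear H0 H3.
  rewrite !INR_IZR_INZ in *.
  set (a := Z.of_nat (fib (i + 1))) in *.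
  set (b := Z.of_nat (fib (i + 2))) in *.
  set (p := (b ^ 2 - a ^ 2)%Z).
  set (q := (2 * a * b)%Z).
  set (s := IZR a ^ 2 + IZR b ^ 2) in *.
  assert (Hp : IZR p = IZR b ^ 2 - IZR a ^ 2)
    by (unfold p; rewrite !Z.pow_2_r, minus_IZR, !mult_IZR; ring).
  assert (Hq : IZR q = 2 * IZR a * IZR b)
    by (unfold q; rewrite !mult_IZR; reflexivity).
  assert (Hpq : s ^ 2 = IZR p ^ 2 + IZR q ^ 2)
    by (rewrite Hp, Hq; unfold s; ring).
  assert (Hqp : s ^ 2 = IZR q ^ 2 + IZR p ^ 2) by (rewrite Hpq; ring).
  assert (Hf' : forall x, f x = IZR p * (x ^ 2 + 2 * s * x + IZR p ^ 2))
    by (intro x; rewrite Hf, Hp; ring).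
  assert (Hg' : forall x, g x = IZR q * (x ^ 2 + 2 * s * x + IZR q ^ 2))
    by (intro x; rewrite Hg, Hq; ring).
  assert (H3 : (3 | p * q)%Z) by apply three_divides_product_of_legs.
  replace theta1 with (- s + IZR q) by (rewrite Htheta1, Hq; unfold s; ring).
  replace theta2 with (- s - IZR q) by (rewrite Htheta2, Hq; unfold s; ring).
  replace phi1 with (- s + IZR p) by (rewrite Hphi1, Hp; ring).
  replace phi2 with (- s - IZR p) by (rewrite Hphi2, Hp; ring).
  split; [exact (quadratic_roots _ _ _ _ f Hf' Hpq) |].
  split; [exact (quadratic_roots _ _ _ _ g Hg' Hqp) |].
  split.
  - exact (quadratic_integral_is_integer p q s _ f Hf' Hpq H3).
  - rewrite Z.mul_comm in H3.
    exact (quadratic_integral_is_integer q p s _ g Hg' Hqp H3).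
Qed.
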